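(* Let $\lambda,\mu,\nu\in\Lambda_+$ and $P\in\mathrm{HIVE}^\nu_{\lambda\mu}$. Then $$\widehat{P^\star}=\xi(\widetilde P).$$
   Context: $\Lambda_+$: weakly decreasing $n$-tuples of integers. $\Delta_n=\{(x,y,z)\in\mathbb Z^3_{\ge0}:x+y+z=n\}$; $P:\Delta_n\to\mathbb Z$ satisfies the hive condition if (whenever all points lie in $\Delta_n$) (i) $P(x,y,z)+P(x,y+1,z-1)\ge P(x+1,y,z-1)+P(x-1,y+1,z)$, (ii) $P(x,y,z)+P(x+1,y,z-1)\ge P(x,y+1,z-1)+P(x+1,y-1,z)$, (iii) $P(x,y,z)+P(x+1,y-1,z)\ge P(x+1,y,z-1)+P(x,y-1,z+1)$; hives are such functions modulo constants; $\mathrm{HIVE}^\nu_{\lambda\mu}$: hives with $\lambda_k=P(n-k,k,0)-P(n-k+1,k-1,0)$, $\mu_k=P(k,0,n-k)-P(k-1,0,n-k+1)$, $\nu_k=P(0,k,n-k)-P(0,k-1,n-k+1)$. $\widehat P(i,j)=P(i-j,j,n-i)-P(i-j+1,j-1,n-i)$ and $\widetilde P(i,j)=P(j,n-i,i-j)-P(j-1,n-i,i-j+1)$, $1\le j\le i\le n$ (Gelfand–Tsetlin patterns, i.e. arrays with $T(i,j)\ge T(i-1,j)\ge T(i,j+1)$). $P^\star$: let $\mathcal L=\{(x,y,t)\in\mathbb Z^3:0\le x,y\le n,\ x+y+t\text{ even}\}$. Put $f(z,x,n-y)=P(x,y,z)$ (defining $f$ on points with $t=x+y\le n$), and extend $f$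 inductively in $t$ to all points of $\mathcal L$ with $x+y\le t\le 2n-x-y$ by the modified octahedron recurrence: $f(x,y,t+1)=\max(f(x+1,y,t)+f(x-1,y,t),f(x,y+1,t)+f(x,y-1,t))-f(x,y,t-1)$ if $0<x,y<n$; $=f(x+1,y,t)+f(x-1,y,t)-f(x,y,t-1)$ if $0<x<n,y\in\{0,n\}$; $=f(x,y+1,t)+f(x,y-1,t)-f(x,y,t-1)$ if $0<y<n,x\in\{0,n\}$; $=f(x+1,y,t)+f(x,y+1,t)-f(x,y,t-1)$ at $(0,0)$; $=f(x+1,y,t)+f(x,y-1,t)-f(x,y,t-1)$ at $(0,n)$; $=f(x-1,y,t)+f(x,y+1,t)-f(x,y,t-1)$ at $(n,0)$; $=f(x-1,y,t)+f(x,y-1,t)-f(x,y,t-1)$ at $(n,n)$. Then $P^\star(x,y,z)=f(x,y,n+z)$. Schützenberger involution on Gelfand–Tsetlin patterns: the Bender–Knuth move $s_i$ ($1\le i\le n-1$) changes only row $i$: $s_i(T)(i,j)=\min(T(i+1,j),T(i-1,j-1))+\max(T(i+1,j+1),T(i-1,j))-T(i,j)$, where an undefined argument is omitted from the min/max; $\xi=s_1(s_2s_1)\cdots(s_{n-1}\cdots s_1)$ (composition of maps, $s_1$ applied first). *)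

(* Defs.v *)
From HB Require Import structures.
From mathcomp Require Import all_boot all_order all_algebra.

Set Implicit Arguments.
Unset Strict Implicit.
Unset Printing Implicit Defensive.

Import Order.TTheory GRing.Theory Num.Theory.
Local Open Scope ring_scope.

(* Lambda_+ *)
Definition weakly_decreasing n (lam : n.-tuple int) : Prop :=
  sorted (fun a b : int => b <= a) lam.

(* A function Delta_n -> Z is represented by a total function of three natural
   numbers, of which only the values at x + y + z = n matter.  Truncated
   predecessors only occur under hypotheses making them genuine, and those
   hypotheses say exactly that all the points involved lie in Delta_n. *)
Definition hive_condition (n : nat) (P : nat -> nat -> nat -> int) : Prop :=
  forall x y z : nat, (x + y + z)%N = n ->
  [/\ (0 < x)%N -> (0 < z)%N ->
        P x.+1 y z.-1 + P x.-1 y.+1 z <= P x y z + P x y.+1 z.-1,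
      (0 < y)%N -> (0 < z)%N ->
        P x y.+1 z.-1 + P x.+1 y.-1 z <= P x y z + P x.+1 y z.-1
    & (0 < y)%N -> (0 < z)%N ->
        P x.+1 y z.-1 + P x y.-1 z.+1 <= P x y z + P x.+1 y.-1 z].

(* P is a representative of its class modulo constants.  The components
   lam_1, ..., lam_n are the entries lam`_0, ..., lam`_(n-1) of the tuple. *)
Definition HIVE n (lam mu nu : n.-tuple int) (P : nat -> nat -> nat -> int) :
    Prop :=
  hive_condition n P /\
  forall k : nat, (1 <= k)%N -> (k <= n)%N ->
  [/\ lam`_k.-1 = P (n - k)%N k 0%N - P (n - k + 1)%N k.-1 0%N,
      mu`_k.-1 = P k 0%N (n - k)%N - P k.-1 0%N (n - k + 1)%N
    & nu`_k.-1 = P 0%N k (n - k)%N - P 0%N k.-1 (n - k + 1)%N].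

(* Triangular arrays T(i,j) are functions of two natural numbers, meaningful
   for 1 <= j <= i <= n. *)
Definition hive_hat (n : nat) (P : nat -> nat -> nat -> int) : nat -> nat -> int :=
  fun i j => P (i - j)%N j (n - i)%N - P (i - j + 1)%N j.-1 (n - i)%N.

Definition hive_tilde (n : nat) (P : nat -> nat -> nat -> int) :
    nat -> nat -> int :=
  fun i j => P j (n - i)%N (i - j)%N - P j.-1 (n - i)%N (i - j + 1)%N.

(* The modified octahedron recurrence: with g = f(.,.,t) and h = f(.,.,t-1),
   this is f(x,y,t+1), for 0 <= x, y <= n. *)
Definition octahedron_step (n : nat) (g h : nat -> nat -> int) (x y : nat) : int :=
  if (0 < x < n)%N then
    if (0 < y < n)%N then
      Num.max (g x.+1 y + g x.-1 y) (g x y.+1 + g x y.-1) - h x y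
    else g x.+1 y + g x.-1 y - h x y
  else
    if (0 < y < n)%N then g x y.+1 + g x y.-1 - h x y
    else if x == 0%N then
      if y == 0%N then g x.+1 y + g x y.+1 - h x y
      else g x.+1 y + g x y.-1 - h x y
    else
      if y == 0%N then g x.-1 y + g x y.+1 - h x y
      else g x.-1 y + g x y.-1 - h x y.

(* f(x,y,t), meaningful on x + y <= t <= 2n - x - y with x + y + t even.
   The initial condition f(z,x,n-y) = P(x,y,z) on t = x + y is solved for f. *)
Fixpoint octahedron_ext (n : nat) (P : nat -> nat -> nat -> int)
    (x y t : nat) {struct t} : int :=
  if (t <= x + y)%N then P y (n - t)%N x
  else if t is (s.+1 as u).+1 then
    octahedron_step n (fun x' y' => octahedron_ext n P x' y' u)
                      (fun x' y' => octahedron_ext n P x' y' s) x y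
  else 0.

Lemma octahedron_ext_init n P (x y z : nat) : (x + y + z)%N = n ->
  octahedron_ext n P z x (n - y)%N = P x y z.
Proof.
move=> xyz; have t_eq : (n - y)%N = (z + x)%N.
  by rewrite -xyz -addnA addnCA addKn addnC.
have yn : (y <= n)%N by rewrite -xyz -addnA addnCA leq_addr.
have unfold t : (t <= z + x)%N -> octahedron_ext n P z x t = P x (n - t)%N z.
  by case: t => [|t] //= ->.
by rewrite unfold ?t_eq // -t_eq subKn.
Qed.

Lemma octahedron_ext_rec n P (x y t : nat) : (x + y <= t)%N ->
  octahedron_ext n P x y t.+2 =
  octahedron_step n (fun x' y' => octahedron_ext n P x' y' t.+1)
                    (fun x' y' => octahedron_ext n P x' y' t) x y.
Proof.
move=> xy_t; rewrite [LHS]/=.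
by rewrite leqNgt ltnS (leq_trans xy_t (leqnSn t)).
Qed.

Definition hive_star (n : nat) (P : nat -> nat -> nat -> int) :
    nat -> nat -> nat -> int :=
  fun x y z => octahedron_ext n P x y (n + z)%N.

(* s_i.  T(i-1,j-1) is undefined exactly when j = 1, and T(i-1,j) exactly when
   j = i; T(i+1,j) and T(i+1,j+1) are always defined, since i <= n - 1. *)
Definition bender_knuth (i : nat) (T : nat -> nat -> int) : nat -> nat -> int :=
  fun k j =>
    if k == i then
      (if j == 1%N then T i.+1 j else Num.min (T i.+1 j) (T i.-1 j.-1))
      + (if j == i then T i.+1 j.+1 else Num.max (T i.+1 j.+1) (T i.-1 j))
      - T i j
    else T k j.

(* s_m o ... o s_2 o s_1 *)
Fixpoint bender_knuth_sweep (m : nat) (T : nat -> nat -> int) :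
    nat -> nat -> int :=
  if m is k.+1 then bender_knuth k.+1 (bender_knuth_sweep k T) else T.

(* s_1 o (s_2 o s_1) o ... o (s_m o ... o s_1) *)
Fixpoint sweep_product (m : nat) (T : nat -> nat -> int) : nat -> nat -> int :=
  if m is k.+1 then sweep_product k (bender_knuth_sweep k.+1 T) else T.

Definition schutzenberger (n : nat) : (nat -> nat -> int) -> nat -> nat -> int :=
  sweep_product n.-1.

(* Main.v *)
Require Import Defs.
From HB Require Import structures.
From mathcomp Require Import all_boot all_order all_algebra.
From mathcomp Require Import zify.
Set Implicit Arguments.
Unset Strict Implicit.
Unset Printing Implicit Defensive.
Import Order.TTheory GRing.Theory Num.Theory.
Local Open Scope ring_scope.

(** Let D_t(i, j) be the increment of f(., ., t) along the antidiagonal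
    x + y = i, from y = j - 1 to y = j.  Then D_i(i, .) is row i of the tilde
    pattern of P, and D_(2n-i)(i, .) is row i of the hat pattern of P*.  With a
    and b the values of f(., ., t+1) on the antidiagonals i + 1 and i - 1,
    indexed by y, the octahedron recurrence turns D_(t+2)(i, j) + D_t(i, j) into
      max(a_j + b_j, a_(j+1) + b_(j-1)) - max(a_(j-1) + b_(j-1), a_j + b_(j-2))
        = min(a_j - a_(j-1), b_(j-1) - b_(j-2))
          + max(a_(j+1) - a_j, b_j - b_(j-1)),
    so that D_(t+2)(i, .) is the Bender-Knuth transform of D_t(i, .) relative to
    the neighbouring rows of D_(t+1).  After k sweeps of the Schützenberger
    involution, row i has therefore reached time i + 2k, or stopped at its final
    time 2n - i once k >= n - i. *)

Definition octahedron_increment n (P : nat -> nat -> nat -> int) (t i j : nat) :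
    int :=
  octahedron_ext n P (i - j) j t - octahedron_ext n P (i - j).+1 j.-1 t.

Lemma octahedron_increment_bender_knuth n P (t i j : nat)
    (T : nat -> nat -> int) :
  (0 < j <= i)%N -> (i < n)%N -> (i <= t)%N ->
  (forall k, (0 < k <= i.+1)%N ->
     T i.+1 k = octahedron_increment n P t.+1 i.+1 k) ->
  (forall k, (0 < k <= i.-1)%N ->
     T i.-1 k = octahedron_increment n P t.+1 i.-1 k) ->
  T i j = octahedron_increment n P t i j ->
  bender_knuth i T i j = octahedron_increment n P t.+2 i j.
Proof.
case: j => [|y] // /andP[_ ji] lt_in le_it Tup Tdown Ti.
have [x ei] : {x | i = (x + y).+1} by exists (i - y.+1)%N; lia.
rewrite /bender_knuth eqxx Ti !Tup; [|lia..].
rewrite /octahedron_increment.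
have -> : (i - y.+1)%N = x by lia.
have -> : (i.+1 - y.+1)%N = x.+1 by lia.
have -> : (i.+1 - y.+2)%N = x by lia.
rewrite [y.+2.-1]/= [y.+1.-1]/=.
rewrite !octahedron_ext_rec; [|lia..].
rewrite /octahedron_step.
have -> : (0 < x.+1 < n)%N by lia.
have -> : (0 < y.+1 < n)%N by lia.
rewrite eqSS -[(y.+1 == i)%N](_ : (x == 0%N) = _); last by lia.
(* Here x = 0 means j = i and y = 0 means j = 1: the argument dropped from the max or min matches
   the neighbour pair missing from the recurrence on the boundary. *)
case: x ei => [|x] ei; case: y ji ei Ti => [|y] ji ei Ti.
- by rewrite /=; lia.
- have -> : (0 < y.+1 < n)%N by lia.
  rewrite /= Tdown /octahedron_increment; last lia.
  have -> : (i.-1 - y.+1)%N = 0%N by lia.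
  by rewrite /=; lia.
- have -> : (0 < x.+1 < n)%N by lia.
  rewrite /= Tdown /octahedron_increment; last lia.
  have -> : (i.-1 - 1)%N = x by lia.
  by rewrite /=; lia.
- have -> : (0 < x.+1 < n)%N by lia.
  have -> : (0 < y.+1 < n)%N by lia.
  rewrite /= !Tdown /octahedron_increment; [|lia..].
  have -> : (i.-1 - y.+1)%N = x.+1 by lia.
  have -> : (i.-1 - y.+2)%N = x by lia.
  by rewrite /=; lia.
Qed.

Definition increments_after n P (k : nat) (T : nat -> nat -> int) : Prop :=
  forall i j, (0 < j <= i)%N -> (i <= n)%N ->
  T i j = octahedron_increment n P (i + (minn k (n - i)).*2) i j.

(** As m = n - 1 - k, the sweep moves exactly the rows with n - i > k, those not yet at their final
    time. *)
Lemma increments_after_sweep n P (k m : nat) (T : nat -> nat -> int) :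
  (k + m.+1)%N = n -> increments_after n P k T ->
  increments_after n P k.+1 (bender_knuth_sweep m T).
Proof.
move=> kmn Tk.
(* Mid-sweep state: when row l + 1 leaves time l + 1 + 2k, the row below (already moved) and the row
   above (not yet moved) are both at time l + 2 + 2k. *)
have sweepE l : (l <= m)%N -> forall i j, (0 < j <= i)%N -> (i <= n)%N ->
    bender_knuth_sweep l T i j =
    octahedron_increment n P
      (i + (if (i <= l)%N then k.+1 else minn k (n - i)).*2) i j.
  elim: l => [|l IHl] le_lm i j ji le_in.
    by rewrite /= Tk //; case: ifP => //; lia.
  have {}IHl := IHl (ltnW le_lm).
  have [ei|ne_il] := eqVneq i l.+1; last first.
    rewrite /= {1}/bender_knuth (negPf ne_il) IHl //.
    by have -> : (i <= l.+1)%N = (i <= l)%N by lia.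
  subst i; rewrite leqnn doubleS !addnS.
  rewrite [LHS]/(bender_knuth l.+1 (bender_knuth_sweep l T) l.+1 j).
  apply: (octahedron_increment_bender_knuth (T := bender_knuth_sweep l T))
    => [|||a|a|]; try lia.
  - move=> ha; rewrite IHl //; last lia.
    by congr octahedron_increment; case: ifP; lia.
  - move=> ha; rewrite IHl //; last lia.
    by congr octahedron_increment; case: ifP; lia.
  - rewrite IHl //; try lia.
    by congr octahedron_increment; case: ifP; lia.
move=> i j ji le_in; rewrite sweepE //.
by congr octahedron_increment; case: ifP; lia.
Qed.

Lemma increments_after_sweep_product n P (m k : nat) (T : nat -> nat -> int) :
  (k + m.+1)%N = n -> increments_after n P k T ->
  increments_after n P n.-1 (sweep_product m T).
Proof.
elim: m k T => [|m IHm] k T kmn Tk.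
  by have -> : n.-1 = k by lia.
apply: (IHm k.+1); first by rewrite addSnnS.
exact: increments_after_sweep kmn Tk.
Qed.

Lemma increments_after0_tilde n P : increments_after n P 0 (hive_tilde n P).
Proof.
move=> i j ji le_in; rewrite min0n addn0 /octahedron_increment /hive_tilde.
have <- := @octahedron_ext_init n P j (n - i) (i - j) ltac:(lia).
have <- := @octahedron_ext_init n P j.-1 (n - i) (i - j + 1) ltac:(lia).
by rewrite subKn // addn1.
Qed.

Theorem theorem7p15 (n : nat) (lam mu nu : n.-tuple int)
    (hlam : weakly_decreasing lam) (hmu : weakly_decreasing mu)
    (hnu : weakly_decreasing nu)
    (P : nat -> nat -> nat -> int) (hP : HIVE lam mu nu P)
    (i j : nat) (hj : (1 <= j)%N) (hji : (j <= i)%N) (hin : (i <= n)%N) :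
  hive_hat n (hive_star n P) i j = schutzenberger n (hive_tilde n P) i j.
Proof.
have n0 : (0 + n.-1.+1)%N = n by lia.
have /(_ i j) := increments_after_sweep_product n0 (@increments_after0_tilde n P).
rewrite /schutzenberger hj hji hin => -> //.
rewrite /hive_hat /hive_star /octahedron_increment addn1.
(* Since i >= 1, the minimum is n - i. *)
by have -> : (i + (minn n.-1 (n - i)).*2 = n + (n - i))%N by lia.
Qed.
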